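(* In the setting described in the context, suppose that there is a constant $c_\Lambda\ge1$ with $$c_j\le c_\Lambda\quad\text{for all }j,$$ that $a=1/(4k(2c_\Lambda n)^{n-1})$, and that $$\nu\left(\frac{|\underline{\mathbf{x}}_j|}{\nu(|\underline{\mathbf{x}}_j|)^n}\right)\geq\gamma\,\nu(|\underline{\mathbf{x}}_j|)$$ for some constant $\gamma>0$. Then there exists $c=c(k,c_\Lambda,n,\gamma)>0$ such that for all $j$ large enough $$\#(Z_{\boldsymbol{Q}_j}\cap\Lambda)-\mathrm{Vol}\,Z_{\boldsymbol{Q}_j}\geq c\inf_{0<B\leq Q_{max}}\left(\frac{\overline{Q}}{\mu(\Lambda,B)}+\frac{Q_{max}}{B}\right)^{n-1}.$$
   Context: Let $n\ge2$, and let $I\subset\{1,\ldots,n\}$, $C=\{\underline{\mathbf{x}}=(x_1,\ldots,x_n)\in\mathbb{R}^n:x_i=0\text{ for all }i\in I\}$. $|\cdot|$ is the Euclidean norm, $\mathrm{Nm}(\underline{\mathbf{x}}):=|x_1\cdots x_n|$. For $\Gamma\subset\mathbb{R}^n$, $\rho>0$: $\nu(\Gamma,\rho):=\inf\{\mathrm{Nm}(\underline{\mathbf{x}})^{1/n}:\underline{\mathbf{x}}\in\Gamma\setminus C,\ |\underline{\mathbf{x}}|<\rho\}$, $\lambda_1(\Gamma):=\inf\{|\underline{\mathbf{x}}|:\underline{\mathbf{x}}\in\Gamma\setminus\{\mathbf{0}\}\}$, $\mu(\Gamma,\rho):=\min\{\lambda_1(\Gamma\cap C),\nu(\Gamma,\rho)\}$,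 with $\inf\emptyset=\infty$ and $1/\infty=0$. $\Lambda$ is a unimodular lattice (rank $n$, determinant $1$) in $\mathbb{R}^n$ that is weakly admissible, i.e. $\nu(\Lambda,\rho)>0$ for all $\rho>0$, but not admissible, i.e. $\lim_{\rho\to\infty}\nu(\Lambda,\rho)=0$. Write $\nu(\cdot):=\nu(\Lambda,\cdot)$. Let $k\ge1$ be a constant and $\{\underline{\mathbf{x}}_j\}_{j=1}^\infty=\{(x_{j1},\ldots,x_{jn})\}_{j=1}^\infty$ a sequence of pairwise distinct elements of $\Lambda\setminus C$ satisfying $\mathrm{Nm}(\underline{\mathbf{x}}_j)\le k\,\nu(|\underline{\mathbf{x}}_j|)^n$. Let $a>0$ be a constant and put $N_j:=a\,\nu(|\underline{\mathbf{x}}_j|)^{-n}$, $B_{\underline{\mathbf{x}}_j}:=[-|x_{j1}|,|x_{j1}|]\times\cdots\times[-|x_{jn}|,|x_{jn}|]$, $Z_{\boldsymbol{Q}_j}:=N_jB_{\underline{\mathbf{x}}_j}$, $c_j:=\lambda_{n-1}(\Lambda,B_{\underline{\mathbf{x}}_j})$, where $\lambda_i(\Lambda,B_{\underline{\mathbf{x}}_j})$ denotes the $i$-th successive minimum of $\Lambda$ with respect to $B_{\underline{\mathbf{x}}_j}$ (the infimum of the $\lambda>0$ such that $\lambda B_{\underline{\mathbf{x}}_j}$ contains $i$ linearly independent points of $\Lambda$). For each $j$ set $Q_i:=N_j|x_{ji}|$ ($1\le i\le n$), $\overline{Q}:=(Q_1\cdots Q_n)^{1/n}$, $Q_{max}:=\max_iQ_i$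 (dependence on $j$ suppressed), and assume that $Q_i\le\overline{Q}$ for all $i\notin I$. *)

(* Defs.v *)
From HB Require Import structures.
From mathcomp Require Import all_boot all_order all_algebra.
From mathcomp Require Import all_classical all_reals all_analysis.

Set Implicit Arguments.
Unset Strict Implicit.
Unset Printing Implicit Defensive.

Import Order.TTheory GRing.Theory Num.Theory.
Import numFieldNormedType.Exports.

Local Open Scope classical_set_scope.
Local Open Scope ring_scope.

(* Points of R^n are row vectors. Infima are taken in \bar R, where inf of the
   empty set is +oo and +oo^-1 = 0. *)

(* The library norm on 'rV[R]_n is the sup norm, hence this definition. *)
Definition enorm (R : realType) (n : nat) (x : 'rV[R]_n) : R :=
  Num.sqrt (\sum_(i < n) x 0 i ^+ 2).

Definition Nm (R : realType) (n : nat) (x : 'rV[R]_n) : R :=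
  `|\prod_(i < n) x 0 i|.

Definition coordC (R : realType) (n : nat) (I : {set 'I_n}) : set 'rV[R]_n :=
  [set x | forall i, i \in I -> x 0 i = 0].

Definition unimodular_lattice (R : realType) (n : nat) (L : set 'rV[R]_n)
    : Prop :=
  exists A : 'M[R]_n, `|\det A| = 1 /\
    L = [set map_mx intr z *m A | z in [set: 'rV[int]_n]].

Definition nu (R : realType) (n : nat) (I : {set 'I_n}) (G : set 'rV[R]_n)
    (rho : R) : \bar R :=
  ereal_inf [set ((Nm x) `^ n%:R^-1)%:E | x in
    [set x | (G `\` coordC I) x /\ enorm x < rho]].

Definition lambda1 (R : realType) (n : nat) (G : set 'rV[R]_n) : \bar R :=
  ereal_inf [set (enorm x)%:E | x in G `\` [set 0]].

Definition mu (R : realType) (n : nat) (I : {set 'I_n}) (G : set 'rV[R]_n)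
    (rho : R) : \bar R :=
  Order.min (lambda1 (G `&` coordC I)) (nu I G rho).

Definition weakly_admissible (R : realType) (n : nat) (I : {set 'I_n})
    (L : set 'rV[R]_n) : Prop :=
  forall rho : R, 0 < rho -> (0 < nu I L rho)%E.

Definition not_admissible (R : realType) (n : nat) (I : {set 'I_n})
    (L : set 'rV[R]_n) : Prop :=
  nu I L rho @[rho --> +oo] --> 0%E.

Definition box (R : realType) (n : nat) (x : 'rV[R]_n) : set 'rV[R]_n :=
  [set y : 'rV[R]_n | forall i, y 0 i \in `[- `|x 0 i|, `|x 0 i|]%R].

Definition dilate (R : realType) (n : nat) (t : R) (B : set 'rV[R]_n)
    : set 'rV[R]_n :=
  [set t *: y | y in B].

(* The rows of M are the i linearly independent lattice points. *)
Definition succ_min (R : realType) (n : nat) (i : nat) (L B : set 'rV[R]_n)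
    : \bar R :=
  ereal_inf [set l%:E | l in [set l : R | 0 < l /\
    exists M : 'M[R]_(i, n), row_free M /\
      forall r : 'I_i, (L `&` dilate l B) (row r M)]].

(* n-dimensional Lebesgue measure as the n-fold product of lebesgue_measure:
   as for product_measure1, the measure of a set is the integral of the
   measures of its sections (here along the first coordinate). *)
Fixpoint vol (R : realType) (n : nat) : set 'rV[R]_n -> \bar R :=
  match n with
  | 0 => fun A => (\1_A (0 : 'rV[R]_0))%:E
  | m.+1 => fun A =>
      (\int[@lebesgue_measure R]_t
         vol [set v : 'rV[R]_m | A (row_mx (t%:M : 'rV[R]_1) v)])%E
  end.

(* The factor N_j, for x = x_j. Both `fine`s below are harmless for a
   weakly admissible L: there nu > 0, so the argument is never +oo. *)
Definition Nfactor (R : realType) (n : nat) (I : {set 'I_n})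
    (L : set 'rV[R]_n) (a : R) (x : 'rV[R]_n) : R :=
  fine (a%:E / (nu I L (enorm x)) ^+ n)%E.

Definition expanded_radius (R : realType) (n : nat) (I : {set 'I_n})
    (L : set 'rV[R]_n) (x : 'rV[R]_n) : R :=
  fine ((enorm x)%:E / (nu I L (enorm x)) ^+ n)%E.

Definition sides (R : realType) (n : nat) (I : {set 'I_n})
    (L : set 'rV[R]_n) (a : R) (x : 'rV[R]_n) (i : 'I_n) : R :=
  Nfactor I L a x * `|x 0 i|.

Definition Qbar (R : realType) (n : nat) (Q : 'I_n -> R) : R :=
  (\prod_(i < n) Q i) `^ n%:R^-1.

(* The default value 0 is immaterial, as the Q i are nonnegative. *)
Definition Qmax (R : realType) (n : nat) (Q : 'I_n -> R) : R :=
  \big[Num.max/0]_(i < n) Q i.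

(* Main.v *)
(* Let nu_j = nu(|x_j|) and let v_1, ..., v_{n-1} be independent lattice points
   in l B_{x_j} with l < c_Lambda n / (n-1). The combinations of the v_i with
   coefficients in {0, ..., T}, T = floor (N_j / ((n-1) l)), lie in Z_{Q_j}, so
   Z_{Q_j} contains at least (N_j / (c_Lambda n))^{n-1} lattice points, and the
   choice of a makes Vol Z_{Q_j} at most half of this. On the other side take
   B = |x_j|: as |x_j| tends to infinity, nu_j tends to 0 and is eventually
   below lambda_1(Lambda cap C), so mu(Lambda, B) = nu_j, and both Qbar / nu_j
   and Qmax / B are O(N_j). *)

Require Import Defs.
From mathcomp Require Import all_boot all_order all_algebra finmap.
From mathcomp Require Import all_classical all_reals all_analysis.
From mathcomp Require Import zify ring lra.
Import Order.TTheory GRing.Theory Num.Theory.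
Import numFieldNormedType.Exports.
Local Open Scope classical_set_scope.
Local Open Scope ring_scope.
Set Implicit Arguments.
Unset Strict Implicit.

(** * Volume of boxes centred at the origin *)

Lemma vol_set0 (R : realType) (n : nat) : vol (@set0 'rV[R]_n) = 0%E.
Proof.
elim: n => [|n IHn] /=; first by rewrite indicE in_set0.
under eq_integral => t _ do
  rewrite (_ : [set v : 'rV[R]_n | set0 (row_mx (t%:M : 'rV_1) v)] = set0) //
    IHn.
by rewrite integral0.
Qed.

(** Induction on the dimension: the section at [t] is the box in the remaining coordinates if [t]
    lies in the first interval and empty otherwise, so the integrand is a constant cut off to that
    interval. *)
Lemma vol_centered_box (R : realType) (n : nat) (b : 'I_n -> R) :
  (forall i, 0 <= b i) ->
  vol [set v : 'rV[R]_n | forall i, v 0 i \in `[- b i, b i]] =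
  (\prod_(i < n) (2 * b i))%:E.
Proof.
elim: n b => [|n IHn] b b_ge0 /=.
  by rewrite big_ord0 indicE mem_set //= => -[].
set box' := [set v : 'rV[R]_n |
  forall i, v 0 i \in `[- b (lift ord0 i), b (lift ord0 i)]].
have sectionE (t : R) :
    vol [set v : 'rV[R]_n |
      forall i, row_mx (t%:M : 'rV[R]_1) v 0 i \in `[- b i, b i]] =
    (cst (vol box') \_ `[- b ord0, b ord0]) t.
  have rowE0 (v : 'rV[R]_n) : row_mx (t%:M : 'rV[R]_1) v 0 ord0 = t.
    have -> : (ord0 : 'I_(1 + n)) = lshift n ord0 by apply: val_inj.
    by rewrite row_mxEl mxE.
  have rowES (v : 'rV[R]_n) i :
      row_mx (t%:M : 'rV[R]_1) v 0 (lift ord0 i) = v 0 i.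
    have -> : lift ord0 i = rshift 1 i :> 'I_(1 + n) by apply: val_inj.
    by rewrite row_mxEr.
  rewrite patchE; case: ifPn => [|/negP tb].
    rewrite inE /= => tb; congr vol; apply/seteqP; split=> v /= vb i.
      by rewrite -(rowES v); exact: vb.
    by case: (unliftP ord0 i) => [j|] ->; rewrite ?rowES ?rowE0.
  rewrite -[RHS](vol_set0 R n); congr vol; apply/seteqP; split=> v //= vb.
  by apply: tb; rewrite inE /= -(rowE0 v); exact: vb.
under eq_integral => t _ do rewrite sectionE.
have length_itv : lebesgue_measure (`[- b ord0, b ord0]%classic : set R) =
    (2 * b ord0)%:E.
  rewrite lebesgue_measure_itv /= lte_fin.
  (* The length formula gives 0 unless the endpoints are strictly ordered; in that case [b ord0 = 0]
     and both sides vanish. *)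
  have [_|b_le0] := ltP; first by rewrite -EFinD opprK mulr2n mulrDl mul1r.
  by have -> : b ord0 = 0 by [have := b_ge0 ord0; lra]; rewrite mulr0.
rewrite -integral_mkcond integral_cst // /box' IHn // big_ord_recl muleC EFinM.
by congr (_ * _)%E.
Qed.

(** * Euclidean norm against coordinates *)

Lemma coord_le_enorm (R : realType) (n : nat) (x : 'rV[R]_n) i :
  `|x 0 i| <= enorm x.
Proof.
rewrite -sqrtr_sqr ler_sqrt; last by apply: sumr_ge0 => j _; exact: sqr_ge0.
by rewrite (bigD1 i) //= lerDl sumr_ge0 // => j _; exact: sqr_ge0.
Qed.

Lemma enorm_ge0 (R : realType) (n : nat) (x : 'rV[R]_n) : 0 <= enorm x.
Proof. exact: sqrtr_ge0. Qed.

Lemma enorm_gt0 (R : realType) (n : nat) (x : 'rV[R]_n) i :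
  x 0 i != 0 -> 0 < enorm x.
Proof.
by move=> xi0; apply: lt_le_trans (coord_le_enorm x i); rewrite normr_gt0.
Qed.

(** The factor [n], cruder than its square root, is absorbed later by [m.+1%:R <= N]. *)
Lemma enorm_le_coord (R : realType) (n : nat) (x : 'rV[R]_n) (m : R) :
  (forall i, `|x 0 i| <= m) -> enorm x <= n%:R * m.
Proof.
case: n x => [|n] x xm; first by rewrite mul0r /enorm big_ord0 sqrtr0.
have m_ge0 : 0 <= m by apply: le_trans (xm ord0).
rewrite -(ger0_norm (mulr_ge0 (ler0n R n.+1) m_ge0)) -sqrtr_sqr ler_sqrt.
  apply: (@le_trans _ _ (\sum_(i < n.+1) m ^+ 2)).
    apply: ler_sum => i _; rewrite -(real_normK (num_real _)).
    by rewrite lerXn2r ?nnegrE // (xm i).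
  rewrite sumr_const card_ord -[leLHS]mulr_natl exprMn ler_wpM2r ?sqr_ge0 //.
  by rewrite -natrX ler_nat -mulnn leq_pmulr.
exact: sqr_ge0.
Qed.

(** * Discreteness of the lattice *)

Lemma lattice_coord_bound (R : realType) (n : nat) (A : 'M[R]_n) :
  A \in unitmx ->
  exists2 K : R, 0 < K & forall (z : 'rV[R]_n) i,
    `|z 0 i| <= K * enorm (z *m A).
Proof.
(* Writing [z] as [z *m A] times [invmx A] bounds its coordinates by this sum times the norm. The
   sum is 0 for [n = 0], hence the added 1. *)
move=> uA; pose K := \sum_(j < n) \sum_(i < n) `|invmx A j i|.
have K_ge0 : 0 <= K by do 2![apply: sumr_ge0 => ? _].
exists (K + 1) => [|z i]; first by rewrite ltr_wpDl.
apply: (@le_trans _ _ (K * enorm (z *m A))); last first.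
  by rewrite ler_wpM2r ?enorm_ge0 ?lerDl.
rewrite -{1}(mulmxK uA z) [X in `|X|]mxE (le_trans (ler_norm_sum _ _ _)) //.
rewrite mulr_suml ler_sum // => j _.
rewrite normrM mulrC ler_pM ?coord_le_enorm //.
by rewrite (bigD1 i) //= lerDl sumr_ge0.
Qed.

Lemma unimodularP (R : realType) (n : nat) (L : set 'rV[R]_n) :
  unimodular_lattice L -> exists2 A : 'M[R]_n, A \in unitmx &
    L = [set map_mx intr z *m A | z in [set: 'rV[int]_n]].
Proof.
move=> [A [detA ->]]; exists A => //.
by rewrite unitmxE unitfE -normr_gt0 detA.
Qed.

(** The integer coordinates of a lattice point in the ball are at most [K * r] in absolute value,
    which leaves finitely many integer vectors. *)
Lemma lattice_ball_finite (R : realType) (n : nat) (L : set 'rV[R]_n) (r : R) :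
  unimodular_lattice L -> finite_set (L `&` [set y | enorm y <= r]).
Proof.
move=> /unimodularP[A uA ->]; have [K K_gt0 KP] := lattice_coord_bound uA.
pose m := Num.truncn (K * r).
(* The ordinals below [m.*2.+1] encode the integers from [-m] to [m], shifted by [m]. *)
pose f (g : {ffun 'I_n -> 'I_(m.*2.+1)}) : 'rV[R]_n :=
  map_mx intr (\row_i ((g i)%:Z - m%:Z)) *m A.
apply: (@sub_finite_set _ _ (f @` [set: {ffun 'I_n -> 'I_(m.*2.+1)}]));
  last first.
  exact/finite_image/finite_finset.
move=> _ [[z _ <-] /= zr].
have zm i : (`|z 0%R i|%N <= m)%N.
  have := le_trans (KP (map_mx intr z) i) (ler_wpM2l (ltW K_gt0) zr).
  by rewrite mxE -intr_norm -abszE -pmulrn => zKr; rewrite truncn_ge_nat //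
    (le_trans _ zKr).
exists [ffun i => inord `|(z 0 i + m%:Z)%R|%N] => //.
congr (map_mx intr _ *m A); apply/rowP => i; rewrite !mxE ffunE.
by move: (z 0 i) (zm i) => w; move: m {f zm} => m wm; rewrite inordK; lia.
Qed.

(** A ball holds finitely many lattice points and, by injectivity, each is [x j] for at most one
    [j]; beyond the largest such index the sequence stays outside the ball. *)
Lemma lattice_enorm_cvgy (R : realType) (n : nat) (L : set 'rV[R]_n)
    (x : nat -> 'rV[R]_n) :
  unimodular_lattice L -> injective x -> (forall j, L (x j)) ->
  enorm (x j) @[j --> \oo] --> +oo.
Proof.
move=> uL inj_x Lx; apply/cvgryPge => r.
set S := x @^-1` (L `&` [set y | enorm y <= r]).
have fin : finite_set S.
  by apply: finite_preimage (lattice_ball_finite r uL) => ? ? _ _; exact: inj_x.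
exists (\max_(i <- finmap.enum_fset (fset_set S)) i).+1 => //.
move=> j /= mj; apply: contraTT mj; rewrite -ltNge -ltnNge => xjr.
have jS : j \in fset_set S.
  by rewrite in_fset_set // inE; split => //=; exact: ltW.
exact: (leq_bigmax_seq (F := id) j).
Qed.

(** A nonzero integer vector has a coordinate of absolute value at least 1, so nonzero lattice
    points have norm at least [K^-1]. This later identifies [mu] with [nu]. *)
Lemma lattice_lambda1_gt0 (R : realType) (n : nat) (L : set 'rV[R]_n) :
  unimodular_lattice L ->
  exists2 d : R, 0 < d & forall C, (d%:E <= lambda1 (L `&` C))%E.
Proof.
move=> /unimodularP[A uA ->]; have [K K_gt0 KP] := lattice_coord_bound uA.
exists K^-1 => [|C]; first by rewrite invr_gt0.
apply: le_ereal_inf_tmp => _ [y [[[z _ <-] _] y0] <-]; rewrite lee_fin.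
have [i zi0] : exists i, z 0 i != 0.
  apply: contra_notP y0 => /forallNP z0; have -> : z = 0.
    by apply/rowP => i; have := z0 i; rewrite mxE => /negP/negPn/eqP.
  by rewrite map_mx0 mul0mx.
rewrite -[K^-1]mul1r ler_pdivrMr // mulrC.
apply: le_trans (KP (map_mx intr z) i).
by rewrite mxE -intr_norm (ler_int R 1) -gtz0_ge1 normr_gt0.
Qed.


(** * Counting lattice points in boxes *)

Lemma counting_ge_card (R : realType) (T : choiceType) (I : finType)
    (A : set T) (f : I -> T) :
  injective f -> (forall i, A (f i)) -> (#|I|%:R%:E <= counting A :> \bar R)%E.
Proof.
move=> inj_f Af; rewrite /counting; case: asboolP => [finA|_]; last first.
  by rewrite leey.
rewrite lee_fin ler_nat cardE -(size_map f).
apply: uniq_leq_size => [|_ /mapP[i _ ->]].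
  by rewrite map_inj_uniq ?enum_uniq.
by rewrite in_fset_set ?inE.
Qed.

(** Combinations of the rows of [M] with coefficients in [0..T] are distinct because [M] is free,
    and stay in the box because each of the [m] terms contributes at most [N * b i / m] to
    coordinate [i]. *)
Lemma lattice_box_counting (R : realType) (n m : nat) (L : set 'rV[R]_n)
    (M : 'M[R]_(m, n)) (b : 'I_n -> R) (l N : R) :
  unimodular_lattice L -> row_free M -> (forall r, L (row r M)) ->
  (forall r i, `|M r i| <= l * b i) -> 0 < l -> 0 <= N -> (0 < m)%N ->
  (((N / (m%:R * l)) ^+ m)%:E <=
   counting ([set v : 'rV[R]_n |
     forall i, v 0%R i \in `[- (N * b i), N * b i]%R] `&` L))%E.
Proof.
move=> /unimodularP[A _ ->] freeM LM Mb l_gt0 N_ge0 m_gt0.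
have ml_gt0 : 0 < m%:R * l by rewrite mulr_gt0 ?ltr0n.
have t_ge0 : 0 <= N / (m%:R * l) by rewrite divr_ge0 // ltW.
pose T := Num.truncn (N / (m%:R * l)).
pose f (g : {ffun 'I_m -> 'I_T.+1}) : 'rV[R]_n := (\row_r (g r)%:R) *m M.
apply: (@le_trans _ _ (#|{ffun 'I_m -> 'I_T.+1}|%:R%:E)).
  (* As 0 is also a coefficient, there are [T.+1] choices per row, so rounding down costs
     nothing. *)
  rewrite card_ffun !card_ord natrX lee_fin lerXn2r ?nnegrE //.
  exact/ltW/truncnS_gt.
apply: (@counting_ge_card R _ _ _ f) => [g h /(row_free_inj freeM) /rowP gh|g].
  apply/ffunP => r; apply/val_inj/eqP; rewrite -(eqr_nat R).
  by have := gh r; rewrite !mxE => ->.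
split=> [i /=|].
  rewrite in_itv /= -ler_norml mxE (le_trans (ler_norm_sum _ _ _)) //.
  have term r : `|(\row_r (g r)%:R : 'rV[R]_m) 0 r * M r i| <=
      N / (m%:R * l) * (l * b i).
    rewrite normrM mxE normr_nat ler_pM //.
    by rewrite -truncn_ge_nat // -ltnS.
  apply: (@le_trans _ _ (\sum_(r < m) N / (m%:R * l) * (l * b i))).
    exact: ler_sum.
  rewrite sumr_const card_ord -[leLHS]mulr_natl.
  suff -> : m%:R * (N / (m%:R * l) * (l * b i)) = N * b i by [].
  by field; rewrite pnatr_eq0 -lt0n m_gt0 gt_eqF.
have /choice[Z ZP] :
    forall r, exists z : 'rV[int]_n, map_mx intr z *m A = row r M.
  by move=> r; have [z _ zE] := LM r; exists z.
exists ((\row_r (g r)%:Z) *m (\matrix_r Z r)) => //.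
rewrite map_mxM -mulmxA; congr (_ *m _).
  by apply/rowP => r; rewrite !mxE.
by apply/row_matrixP => r; rewrite row_mul -map_row rowK ZP.
Qed.

(** * Bounds at a single lattice point *)

Lemma dilate_box (R : realType) (n : nat) (t : R) (x : 'rV[R]_n) :
  0 < t ->
  dilate t (box x) =
  [set v : 'rV[R]_n | forall i, v 0 i \in `[- (t * `|x 0 i|), t * `|x 0 i|]].
Proof.
move=> t_gt0; apply/seteqP; split=> [_ [y yx <-] i|v vx].
  have := yx i; rewrite !in_itv /= -!ler_norml mxE normrM gtr0_norm // => ?.
  by rewrite ler_pM2l.
exists (t^-1 *: v); last by rewrite scalerA divff ?scale1r ?gt_eqF.
move=> i; have := vx i; rewrite !in_itv /= -!ler_norml mxE normrM.
by rewrite gtr0_norm ?invr_gt0 // ler_pdivrMl.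
Qed.

(** Here [v] stands for [nu] at [enorm x], and [N * v ^+ m.+1] is the constant [a]. With
    [t = N / (cL * m.+1%:R)], the count is at least [t ^+ m] and the volume at most half of that. *)
Lemma excess_ge (R : realType) (m : nat) (L : set 'rV[R]_m.+1)
    (x : 'rV[R]_m.+1) (k cL N v : R) :
  (0 < m)%N -> unimodular_lattice L -> 1 <= k -> 1 <= cL -> 0 < N ->
  N * v ^+ m.+1 = 1 / (4 * k * (2 * cL * m.+1%:R) ^+ m) ->
  Nm x <= k * v ^+ m.+1 -> (succ_min m L (box x) <= cL%:E)%E ->
  (((N / (cL * m.+1%:R)) ^+ m / 2)%:E <=
   counting (dilate N (box x) `&` L) - vol (dilate N (box x)))%E.
Proof.
move=> m_gt0 uL k_ge1 cL_ge1 N_gt0 Nv xk cL_min.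
have m1_gt0 : 0 < m%:R :> R by rewrite ltr0n.
have cL_gt0 : 0 < cL by apply: lt_le_trans cL_ge1.
have cn_gt0 : 0 < cL * m.+1%:R by rewrite mulr_gt0.
rewrite dilate_box // vol_centered_box => [|i]; last by rewrite mulr_ge0 // ltW.
(* The infimum is at most [cL]; the slack factor [m.+1 / m > 1] yields an actual [l] without knowing
   that the infimum is attained. *)
have [_ [l [l_gt0 [M [freeM LM]]] <-] l_lt] : exists2 y : \bar R,
    [set l%:E | l in [set l : R | 0 < l /\
      exists M : 'M[R]_(m, m.+1), row_free M /\
        forall r : 'I_m, (L `&` dilate l (box x)) (row r M)]] y &
    (y < (cL * m.+1%:R / m%:R)%:E)%E.
  apply: ereal_inf_lt; apply: (le_lt_trans cL_min).
  by rewrite lte_fin -mulrA ltr_pMr // ltr_pdivlMr // mul1r ltr_nat.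
have Mx r i : `|M r i| <= l * `|x 0 i|.
  have [_] := LM r; rewrite dilate_box //= => /(_ i).
  by rewrite mxE in_itv /= -ler_norml.
have count := lattice_box_counting uL freeM (fun r => (LM r).1) Mx l_gt0
  (ltW N_gt0) m_gt0.
set t := N / (cL * m.+1%:R) in count *.
have t_le : t ^+ m <= (N / (m%:R * l)) ^+ m.
  have t_ge0 : 0 <= t by rewrite divr_ge0 // ltW.
  rewrite lerXn2r ?nnegrE ?divr_ge0 ?mulr_ge0 ?(ltW N_gt0) ?(ltW l_gt0)
    ?(ltW cL_gt0) //.
  rewrite /t ler_pM2l // lef_pV2 ?posrE ?mulr_gt0 //.
  by rewrite mulrC -ler_pdivlMr // ltW // -lte_fin.
(* The bound on [Nm x] splits off [2 * k * (N * v ^+ m.+1)] from [(2 * N) ^+ m]; the prescribed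
   value of [N * v ^+ m.+1] makes the product exactly [t ^+ m / 2]. *)
have vol_le : \prod_(i < m.+1) (2 * (N * `|x 0 i|)) <= t ^+ m / 2.
  have -> : \prod_(i < m.+1) (2 * (N * `|x 0 i|)) = (2 * N) ^+ m.+1 * Nm x.
    have -> : (2 * N) ^+ m.+1 = \prod_(i < m.+1) (2 * N).
      by rewrite prodr_const card_ord.
    by rewrite /Nm normr_prod -big_split; apply: eq_bigr => i _; rewrite mulrA.
  apply: (@le_trans _ _ ((2 * N) ^+ m.+1 * (k * v ^+ m.+1))).
    by rewrite ler_pM2l // exprn_gt0 // mulr_gt0.
  have -> : (2 * N) ^+ m.+1 * (k * v ^+ m.+1) =
      (2 * N) ^+ m * (2 * k * (N * v ^+ m.+1)) by rewrite exprS; ring.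
  rewrite Nv /t -mulrA !exprMn exprVn !exprMn; 
  rewrite le_eqVlt; apply/orP; left; apply/eqP; field.
  by rewrite !expf_neq0 ?pnatr_eq0 // gt_eqF // (lt_le_trans _ k_ge1).
rewrite leeBrDr //; apply: le_trans count; rewrite -EFinD lee_fin.
lra.
Qed.

(** The infimum is bounded by its term at [B = enorm x], where [Qbar Q / v <= N * k] and
    [Qmax Q / B <= N]. *)
Lemma inf_error_term_le (R : realType) (m : nat) (I : {set 'I_m.+1})
    (L : set 'rV[R]_m.+1) (x : 'rV[R]_m.+1) (k N v : R) (Q : 'I_m.+1 -> R) :
  (forall i, Q i = N * `|x 0 i|) -> 1 <= k -> 0 < v ->
  nu I L (enorm x) = v%:E ->
  (v%:E <= lambda1 (L `&` coordC I))%E ->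
  Nm x <= k * v ^+ m.+1 -> 0 < enorm x -> m.+1%:R <= N ->
  (ereal_inf
     [set ((Qbar Q)%:E / mu I L B + (Qmax Q / B)%R%:E) ^+ m |
          B in [set B : R | (0 < B <= Qmax Q)%R]] <=
   ((N * (k + 1)) ^+ m)%:E)%E.
Proof.
move=> QE k_ge1 v_gt0 nuE v_le xk x_gt0 nN.
have N_gt0 : 0 < N by apply: lt_le_trans nN.
have k_gt0 : 0 < k by apply: lt_le_trans k_ge1.
have Q_le i : Q i <= Qmax Q by exact: le_bigmax_cond.
have Qmax_ge0 : 0 <= Qmax Q.
  by apply: le_trans (Q_le ord0); rewrite QE mulr_ge0 // ltW.
(* The choice [B = enorm x] is allowed: the factor [m.+1] lost in [enorm_le_coord] is compensated by
   [m.+1%:R <= N]. *)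
have x_le_Qmax : enorm x <= Qmax Q.
  apply: (@le_trans _ _ (m.+1%:R * (Qmax Q / N))).
    by apply: enorm_le_coord => i; rewrite ler_pdivlMr // mulrC -QE Q_le.
  by rewrite mulrCA ler_piMr // ler_pdivrMr // mul1r.
have Qmax_le : Qmax Q <= N * enorm x.
  apply: bigmax_le => [|i _]; first by rewrite mulr_ge0 ?enorm_ge0 // ltW.
  by rewrite QE ler_pM2l // coord_le_enorm.
(* Since [1 <= k], [k] is at most its power [k ^+ m.+1], which avoids a root of [k]. *)
have Qbar_le : Qbar Q <= N * k * v.
  have Nkv_ge0 : 0 <= N * k * v by rewrite !mulr_ge0 // ltW.
  have root_Xn : ((N * k * v) ^+ m.+1) `^ m.+1%:R^-1 = N * k * v.
    by rewrite -powR_mulrn // -powRrM mulfV ?pnatr_eq0 // powRr1.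
  rewrite -root_Xn; apply: ge0_ler_powR.
  - by rewrite invr_ge0.
  - by rewrite nnegrE prodr_ge0 // => i _; rewrite QE mulr_ge0 // ltW.
  - by rewrite nnegrE exprn_ge0.
  have -> : \prod_(i < m.+1) Q i = N ^+ m.+1 * Nm x.
    have -> : N ^+ m.+1 = \prod_(i < m.+1) N by rewrite prodr_const card_ord.
    by rewrite /Nm normr_prod -big_split; apply: eq_bigr => i _; rewrite QE.
  rewrite !exprMn -mulrA ler_pM2l ?exprn_gt0 //.
  apply: (le_trans xk); rewrite ler_wpM2r ?exprn_ge0 ?(ltW v_gt0) //.
  by rewrite exprS ler_peMr ?(ltW k_gt0) // exprn_ege1.
apply: (@le_trans _ _ ((Qbar Q / v + Qmax Q / enorm x) ^+ m)%:E).
  apply: ereal_inf_lbound; exists (enorm x); first by rewrite /= x_gt0.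
  rewrite /mu nuE; have -> : Order.min (lambda1 (L `&` coordC I)) v%:E = v%:E.
    exact/min_idPr.
  by rewrite inver gt_eqF // -EFinM -EFinD EFin_expe.
have Qbar_ge0 : 0 <= Qbar Q by exact: powR_ge0.
rewrite lee_fin lerXn2r ?nnegrE ?addr_ge0 ?mulr_ge0 ?invr_ge0 ?addr_ge0
  ?(ltW N_gt0) ?(ltW v_gt0) ?(ltW x_gt0) ?(ltW k_gt0) //.
by rewrite mulrDr mulr1 lerD // ler_pdivrMr.
Qed.

(** * Passage to large indices *)

Unset Implicit Arguments.

Theorem proposition7p1 (R : realType) (n : nat) (n_ge2 : (2 <= n)%N)
    (k cL gamma : R) (k_ge1 : 1 <= k) (cL_ge1 : 1 <= cL)
    (gamma_gt0 : 0 < gamma) :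
  exists2 c : R, 0 < c &
  forall (I : {set 'I_n}) (L : set 'rV[R]_n) (x : nat -> 'rV[R]_n) (a : R),
  unimodular_lattice L ->
  weakly_admissible I L ->
  not_admissible I L ->
  injective x ->
  (forall j, (L `\` coordC I) (x j)) ->
  (forall j, ((Nm (x j))%:E <= k%:E * nu I L (enorm (x j)) ^+ n)%E) ->
  0 < a ->
  a = 1 / (4 * k * (2 * cL * n%:R) ^+ n.-1) ->
  (forall j i, i \notin I ->
     sides I L a (x j) i <= Qbar (sides I L a (x j))) ->
  (forall j, (succ_min n.-1 L (box (x j)) <= cL%:E)%E) ->
  (forall j, (gamma%:E * nu I L (enorm (x j)) <=
              nu I L (expanded_radius I L (x j)))%E) ->
  \forall j \near \oo,
    let Q := sides I L a (x j) in
    let Z := dilate (Nfactor I L a (x j)) (box (x j)) in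
    (c%:E * ereal_inf
       [set ((Qbar Q)%:E / mu I L B + (Qmax Q / B)%R%:E) ^+ n.-1 |
          B in [set B : R | (0 < B <= Qmax Q)%R]]
     <= counting (Z `&` L) - vol Z)%E.
Proof.
case: n n_ge2 => [//|m] m_gt0; rewrite ltnS in m_gt0.
have k_gt0 : 0 < k by apply: lt_le_trans k_ge1.
have cL_gt0 : 0 < cL by apply: lt_le_trans cL_ge1.
have D_gt0 : 0 < cL * m.+1%:R * (k + 1) by rewrite !mulr_gt0 // addr_gt0.
(* This is the ratio of the lower bound [(N / (cL * m.+1%:R)) ^+ m / 2] for the excess to the upper
   bound [(N * (k + 1)) ^+ m] for the infimum. *)
exists (2 * (cL * m.+1%:R * (k + 1)) ^+ m)^-1.
  by rewrite invr_gt0 mulr_gt0 // exprn_gt0.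
move=> I L x a uL wadm nadm inj_x Lx xk a_gt0 aE _ xcL _.
have [d d_gt0 dP] := lattice_lambda1_gt0 uL.
have xy := lattice_enorm_cvgy uL inj_x (fun j => (Lx j).1).
(* Finiteness holds only eventually: for small radii [nu] may be an infimum over the empty set. *)
have := (cvge_pinftyP _ _).1 nadm _ xy => /fine_cvgP[nu_fin nu_cvg].
(* For [v < e]: [v < d] puts [v] below [lambda1], while [v < 1] and [v < a / m.+1%:R] give
   [v ^+ m.+1 <= v <= a / m.+1%:R], that is [m.+1%:R <= N]. *)
pose e := Num.min d (Num.min 1 (a / m.+1%:R)).
have e_gt0 : 0 < e by rewrite !lt_min d_gt0 ltr01 divr_gt0.
have nu_lt := (cvgrPdist_lt _ _).1 nu_cvg e e_gt0.
near=> j.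
have xj_gt0 : 0 < enorm (x j).
  have [i /eqP xi] : exists i, x j 0 i <> 0.
    by apply: contra_notP (Lx j).2 => /forallNP x0 i _; exact: contrapT (x0 i).
  exact: enorm_gt0 xi.
have [v nuE] : exists v, nu I L (enorm (x j)) = v%:E.
  exists (fine (nu I L (enorm (x j)))); rewrite fineK //.
  by near: j; exact: nu_fin.
have v_gt0 : 0 < v by rewrite -lte_fin -nuE wadm.
have : v < e.
  have : `|0 - fine (nu I L (enorm (x j)))| < e by near: j; exact: nu_lt.
  by rewrite sub0r normrN nuE /= gtr0_norm.
rewrite !lt_min => /and3P[v_d v_1 v_a].
have NE : Nfactor I L a (x j) = a / v ^+ m.+1.
  by rewrite /Nfactor nuE -EFin_expe inver gt_eqF ?exprn_gt0.
have nN : m.+1%:R <= a / v ^+ m.+1.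
  rewrite ler_pdivlMr ?exprn_gt0 // mulrC -ler_pdivlMr //.
  apply: le_trans (ltW v_a); rewrite exprS ger_pMr //.
  by rewrite exprn_ile1 // ltW.
have N_gt0 : 0 < a / v ^+ m.+1 by rewrite divr_gt0 ?exprn_gt0.
have Nmx : Nm (x j) <= k * v ^+ m.+1.
  by rewrite -lee_fin EFinM EFin_expe -nuE.
have excess := excess_ge m_gt0 uL k_ge1 cL_ge1 N_gt0
  (etrans (divfK _ _) aE) Nmx (xcL j).
have v_lambda1 : (v%:E <= lambda1 (L `&` coordC I))%E.
  by apply: le_trans (dP _); rewrite lee_fin ltW.
have sidesE i : sides I L a (x j) i = a / v ^+ m.+1 * `|x j 0 i|.
  by rewrite /sides NE.
have inf_le :=
  inf_error_term_le sidesE k_ge1 v_gt0 nuE v_lambda1 Nmx xj_gt0 nN.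
rewrite NE /=.
apply: le_trans (excess _); last by rewrite expf_neq0 // gt_eqF.
apply: (@le_trans _ _ ((2 * (cL * m.+1%:R * (k + 1)) ^+ m)^-1%:E *
    ((a / v ^+ m.+1 * (k + 1)) ^+ m)%:E)%E).
  by rewrite lee_pmul2l // lte_fin invr_gt0 mulr_gt0 // exprn_gt0.
(* By the choice of the constant, the two bounds agree exactly. *)
rewrite -EFinM lee_fin le_eqVlt; apply/orP; left; apply/eqP; set N := a / _.
rewrite !(exprMn, exprVn); field.
by rewrite !expf_neq0 ?pnatr_eq0 // gt_eqF // addr_gt0.
Unshelve. all: by end_near.
Qed.
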